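(* For every $\delta>0$ there exists $n_\delta\in\mathbb{N}$ such that the following holds for every $n\ge n_\delta$. Let $G$ be an extremal multicolored triangle-free graph on $n$ vertices. Then there exists a partition of $V(G)$ into pairwise disjoint sets $A_1,\dots,A_5$ such that all but at most $2n/5+\delta n$ edges of $G$ belong to $\bigcup_{i\in[5]} G(A_i,A_{i+1})$ (indices modulo $5$). Moreover, for every $i\in[5]$ we have $$\frac n5-2^4\le |A_i|\le \frac n5+2^6.$$
   Context: All graphs are finite and simple; $[m]=\{1,\dots,m\}$. $C_\ell$ denotes the cycle of length $\ell$. If the edge set of a graph $G$ is the union of $k$ pairwise edge-disjoint subgraphs $F_1,\dots,F_k$, each isomorphic to $C_5$, then a subgraph of $G$ is called multicolored (with respect to this decomposition) if it shares at most one edge with $F_i$ for every $i$. $\mathrm{ex}_{C_5}(C_3,n)$ is the maximum $k$ such that there is a graph on $n$ vertices that is the union of $k$ pairwise edge-disjoint copies of $C_5$ and has no multicolored copy of $C_3$. A graph $G$ on $n$ vertices is an extremal multicolored triangle-free graph if its edge set can be partitioned into $\mathrm{ex}_{C_5}(C_3,n)$ edge-disjoint copies of $C_5$ such that $G$ contains no multicolored copy of $C_3$ (with respect to this partition). $G(A_i,A_{i+1})$ is the bipartite subgraph of $G$ on vertex set $A_i\cup A_{i+1}$ whose edges are the edges $uv\in E(G)$ with $u\in A_i$ and $v\in A_{i+1}$. *)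

(* Defs.v *)
From mathcomp Require Import all_boot.
Set Implicit Arguments.
Unset Strict Implicit.
Unset Printing Implicit Defensive.

(* A graph with vertex set T is given by its edge set E : {set {set T}}.
   Cycles have no isolated vertices, so a copy of a cycle in a graph is
   also identified with its edge set. *)

Section Graphs.
Variable T : finType.
Implicit Types (E F H : {set {set T}}) (A B : {set T}).

Definition simple_graph E : bool := [forall e in E, #|e| == 2].

(* [ordS] is the cyclic successor on 'I_l; the definition is meant for
   3 <= l. *)
Definition cycle_copy (l : nat) F : bool :=
  [exists f : {ffun 'I_l -> T},
     injectiveb f && (F == [set [set f i; f (ordS i)] | i : 'I_l])].

Definition C5_decomposition (k : nat) E
    (F : {ffun 'I_k -> {set {set T}}}) : bool :=
  [&& E == \bigcup_i F i,
      [forall i, cycle_copy 5 (F i)]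
    & [forall i, forall j, (i != j) ==> [disjoint F i & F j]]].

Definition multicolored (k : nat) (F : {ffun 'I_k -> {set {set T}}}) H : bool :=
  [forall i, #|H :&: F i| <= 1].

Definition has_multicolored_C3 (k : nat) E
    (F : {ffun 'I_k -> {set {set T}}}) : bool :=
  [exists H : {set {set T}},
     [&& H \subset E, cycle_copy 3 H & multicolored F H]].

Definition multicolored_C3_free (k : nat) E : bool :=
  simple_graph E &&
  [exists F : {ffun 'I_k -> {set {set T}}},
     C5_decomposition E F && ~~ has_multicolored_C3 E F].

Definition bipartite_between E A B : {set {set T}} :=
  [set e in E | [exists u in A, exists v in B, e == [set u; v]]].

End Graphs.

Definition ex_C5_C3_attains (n k : nat) : bool :=
  [exists E : {set {set 'I_n}}, multicolored_C3_free k E].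

(* The a priori bound 'C(n, 2) on k only makes the maximum range over a
   finite set; it loses nothing, see [ex_C5_C3P]. *)
Definition ex_C5_C3 (n : nat) : nat :=
  \max_(k < ('C(n, 2)).+1 | ex_C5_C3_attains n k) k.

Definition extremal_multicolored_C3_free (T : finType) (E : {set {set T}}) :
    bool :=
  multicolored_C3_free (ex_C5_C3 #|T|) E.

Definition vertex_partition (T : finType) (m : nat) (A : 'I_m -> {set T}) :
    Prop :=
  (forall i j, i != j -> [disjoint A i & A j]) /\ \bigcup_i A i = [set: T].

Lemma cycle_copy_neq0 (T : finType) (l : nat) (F : {set {set T}}) :
  0 < l -> cycle_copy l F -> F != set0.
Proof.
case: l => // l _ /existsP [f /andP [_ /eqP ->]].
by apply/set0Pn; exists [set f ord0; f (ordS ord0)]; apply: imset_f.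
Qed.

Lemma C5_decomposition_leq (T : finType) (k : nat) (E : {set {set T}})
    (F : {ffun 'I_k -> {set {set T}}}) :
  simple_graph E -> C5_decomposition E F -> k <= 'C(#|T|, 2).
Proof.
move=> /forall_inP sE /and3P [/eqP defE /forallP cF /forallP dF].
have nzF i : F i != set0 by apply: cycle_copy_neq0 (cF i).
have ex i : exists e, e \in F i by apply/set0Pn.
pose g i := xchoose (ex i).
have gF i : g i \in F i by exact: xchooseP.
have g_inj : injective g.
  move=> i j eq_g; apply/eqP; apply/negPn/negP => ne_ij.
  have /implyP/(_ ne_ij) /disjointFr/(_ (gF i)) := forallP (dF i) j.
  by rewrite eq_g gF.
rewrite -card_draws -[X in X <= _]card_ord -(card_imset predT g_inj).
apply: subset_leq_card; apply/subsetP => _ /imsetP [i _ ->].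
by rewrite inE sE // defE; apply/bigcupP; exists i.
Qed.

Lemma ex_C5_C3_attains0 (n : nat) : ex_C5_C3_attains n 0.
Proof.
apply/existsP; exists set0; apply/andP; split.
  by apply/forall_inP => e; rewrite inE.
apply/existsP; exists [ffun=> set0]; apply/andP; split.
  by rewrite /C5_decomposition big_ord0 eqxx /=; apply/andP; split;
     apply/forallP => -[].
apply/existsPn => H; rewrite subset0; apply/negP => /and3P [/eqP -> cH _].
by have := cycle_copy_neq0 (isT : 0 < 3) cH; rewrite eqxx.
Qed.

Lemma ex_C5_C3P (n : nat) :
  ex_C5_C3_attains n (ex_C5_C3 n) /\
  forall k, ex_C5_C3_attains n k -> k <= ex_C5_C3 n.
Proof.
split.
  rewrite /ex_C5_C3.
  apply: (big_ind (fun k => ex_C5_C3_attains n k)) => //.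
  - exact: ex_C5_C3_attains0.
  - by move=> a b Ha Hb; rewrite /maxn; case: ifP.
move=> k Hk; have [E /andP [sE /existsP [F /andP [dF _]]]] := existsP Hk.
have lt_k : k < ('C(n, 2)).+1.
  by rewrite ltnS -[n in 'C(n, _)]card_ord; apply: C5_decomposition_leq dF.
exact: (@leq_bigmax_cond _ (fun k : 'I__ => ex_C5_C3_attains n k)
          (fun k : 'I__ => k : nat) (Ordinal lt_k)).
Qed.

(* Main.v *)
Require Import Defs.
From mathcomp Require Import all_boot all_order all_algebra.
From mathcomp Require Import zify lra.
From mathcomp Require Import reals.
Import Order.TTheory GRing.Theory Num.Theory.
Set Implicit Arguments.
Unset Strict Implicit.
Unset Printing Implicit Defensive.

(** Let n be the number of vertices, k the number of pentagons of an extremal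
    decomposition, and m = floor (n / 5).  Two consecutive edges of one pentagon
    form a cherry.  By hypothesis every triangle contains a cherry, and a cherry
    extends to at most one triangle; so the triangles at a vertex v number
    O(deg v) ([card_triangles]), and O(n^2) in all.

    Size of k.  Labelling the five classes of a balanced blow-up of C_5 by
    residues mod m and taking the pentagons x, y, x, y, x + y gives k >= m^2
    ([ex_C5_C3_ge]).

    A typical pentagon.  If a vertex is not adjacent to two consecutive vertices
    of a pentagon, it has at most two neighbours on it, and two only if these
    are the neighbours of a position i of the pentagon.  Summed over vertices
    and pentagons, with the Cauchy-Schwarz inequality for the degrees and
    k >= m^2, this shows that for some pentagon all but at most 47 vertices are
    typical, that is, adjacent exactly to the two neighbours of a position
    ([exists_typical_cycle]).  Sort the vertices by this
    position into five classes, and call an edge stray if it does not join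
    consecutive classes.  Two typical vertices in classes that are not
    consecutive have a common neighbour on the pentagon, so a stray edge spans a
    triangle with one of its five vertices or meets an atypical vertex: there
    are O(n) stray edges ([first_classes]).

    Balance.  A pentagon without stray edges winds once around the classes, so
    it has an edge between any two consecutive classes.  Hence k is at most
    e(A_i, A_(i+1)) plus the number of stray edges ([leq_links]).  With k >= m^2
    this bounds every product |A_i| |A_(i+1)| from below, which forces the
    class sizes to be m + O(1) ([class_sizes]) and leaves only O(n) non-adjacent
    pairs between consecutive classes.

    The constant 2/5.  Only boundedly many vertices miss a fixed proportion of
    their expected neighbours.  As there are few triangles at each of them, it
    can be moved to a class where it has few stray edges ([home_class]).  Any
    other stray edge u v has about n / 5 common neighbours x, and all but two of
    these give a cherry u x v ([codeg_cherries]).  So the number of stray edges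
    times n / 5 is at most, up to lower order, the number of cherries that close
    to a triangle, that is, the number of chords of pentagons.  If a pentagon
    has three chords, two of them meet in a vertex and form, with a side, a
    triangle; these two chords then belong to a common pentagon, and one of the
    two pentagons contains a stray edge, since the pentagon C_5 itself is
    triangle-free.  Thus all but O(n) pentagons have at most two chords
    ([card_crowded]), and the number of stray edges is at most
    (2k + O(n)) / (n / 5) + o(n) = 2n/5 + o(n).  Feeding this bound, which is
    less than 3m, into the balance argument again gives the sizes
    m - 13 <= |A_i| <= m + 10. *)

(** * Double counting *)

(** Choosing for each [x] a related [y] injects [A] into [B]. *)
Lemma leq_card_rel (X Y : finType) (A : {set X}) (B : {set Y})
    (r : X -> Y -> bool) :
  (forall x, x \in A -> exists2 y, y \in B & r x y) ->
  (forall x x' y, r x y -> r x' y -> x = x') ->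
  #|A| <= #|B|.
Proof.
move=> ex inj; pose h x := [pick y in B | r x y].
have hP x : x \in A -> exists2 y, h x = Some y & (y \in B) && r x y.
  move=> /ex [y yB rxy]; rewrite /h; case: pickP => [y' Hy'|/(_ y)].
    by exists y'.
  by rewrite /= yB rxy.
have <- : #|h @: A| = #|A|.
  apply: card_in_imset => x x' /hP [y -> /andP [_ rxy]] /hP [y' -> /andP [_ ry]].
  by case=> eq_y; apply: inj rxy _; rewrite eq_y.
have <- : #|(@Some Y) @: B| = #|B| by apply: card_imset => ? ? [].
apply/subset_leq_card/subsetP => _ /imsetP [x /hP [y -> /andP [yB _]] ->].
exact: imset_f.
Qed.

Lemma sum_card_fibres (X Y : finType) (P : pred X) (R : X -> Y -> bool) :
  \sum_(x | P x) #|[set y | R x y]| = #|[set q : X * Y | P q.1 && R q.1 q.2]|.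
Proof.
rewrite -sum1dep_card (eq_bigr (fun x => \sum_(y | R x y) 1)) ?pair_big_dep //.
by move=> x _; rewrite sum1dep_card.
Qed.

Lemma leq_card_exists (X Y : finType) (R : X -> Y -> bool) :
  #|[set y | [exists x, R x y]]| <= \sum_x #|[set y | R x y]|.
Proof.
rewrite (sum_card_fibres xpredT).
apply: (leq_card_rel (r := fun y q => q.2 == y)) => [y|y y' q]; last first.
  by move=> /eqP <- /eqP.
by rewrite inE => /existsP [x Rxy]; exists (x, y); rewrite ?inE /=.
Qed.

(** * The pentagon *)

Definition step (b : bool) (a : 'I_5) : 'I_5 := if b then ordS a else ord_pred a.

Lemma stepK b : cancel (step b) (step (~~ b)).
Proof. by case: b => a; rewrite /= ?ordSK ?ord_predK. Qed.

Local Notation o0 := (Ordinal (isT : 0 < 5)).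
Local Notation o1 := (Ordinal (isT : 1 < 5)).
Local Notation o2 := (Ordinal (isT : 2 < 5)).
Local Notation o3 := (Ordinal (isT : 3 < 5)).
Local Notation o4 := (Ordinal (isT : 4 < 5)).

Lemma ord5_ind (P : 'I_5 -> Prop) :
  P o0 -> P o1 -> P o2 -> P o3 -> P o4 -> forall i, P i.
Proof.
move=> P0 P1 P2 P3 P4 [i lti].
by case: i lti => [|[|[|[|[|//]]]]] lti;
  [move: P0 | move: P1 | move: P2 | move: P3 | move: P4];
  congr (P _); apply: val_inj.
Qed.

Lemma ordS5 : (ordS o0 = o1) * (ordS o1 = o2) * (ordS o2 = o3) *
  (ordS o3 = o4) * (ordS o4 = o0).
Proof. by do !split; apply: val_inj. Qed.

Lemma ord_pred5 : (ord_pred o0 = o4) * (ord_pred o1 = o0) * (ord_pred o2 = o1) *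
  (ord_pred o3 = o2) * (ord_pred o4 = o3).
Proof. by do !split; apply: val_inj. Qed.

Lemma sum5 (G : 'I_5 -> nat) :
  \sum_a G a = G o0 + G o1 + G o2 + G o3 + G o4.
Proof.
rewrite !big_ord_recl big_ord0 addn0 !addnA.
by do !congr (_ + _); congr G; apply: val_inj.
Qed.

Lemma step_neq b a : step b a != a.
Proof. by elim/ord5_ind: a; case: b. Qed.

Lemma step2_neq b a : step b (step b a) != a.
Proof. by elim/ord5_ind: a; case: b. Qed.

Lemma exists5 (P : pred 'I_5) :
  [exists i, P i] = [|| P o0, P o1, P o2, P o3 | P o4].
Proof.
apply/existsP/idP => [[i]|]; first by elim/ord5_ind: i => ->; rewrite ?orbT.
by case/or4P=> [H|H|H|/orP [H|H]];
  [exists o0 | exists o1 | exists o2 | exists o3 | exists o4].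
Qed.

Lemma forall5 (P : pred 'I_5) :
  [forall i, P i] = [&& P o0, P o1, P o2, P o3 & P o4].
Proof.
apply/forallP/idP => [H|/and5P [? ? ? ? ?]]; first by rewrite !H.
by elim/ord5_ind.
Qed.

Definition consec (i j : 'I_5) := (j == ordS i) || (i == ordS j).

Lemma consecC i j : consec i j = consec j i.
Proof. by rewrite /consec orbC. Qed.

Lemma consec_triangle_free i j l : consec i j -> consec j l -> ~~ consec i l.
Proof. by elim/ord5_ind: i; elim/ord5_ind: j; elim/ord5_ind: l. Qed.

(** Two vertices of C_5 that are not adjacent are equal or at distance two. *)
Lemma nonconsec_common i l : ~~ consec i l -> exists j, consec i j && consec j l.
Proof.
move=> H; apply/existsP; rewrite exists5; move: H.
by elim/ord5_ind: i; elim/ord5_ind: l.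
Qed.

Lemma sum_nonconsec i : \sum_c ~~ consec i c = 3.
Proof. by rewrite sum5; elim/ord5_ind: i. Qed.

(** [S] is the trace of a vertex neighbourhood on a pentagon.  Without a pair of
    consecutive elements it has at most two elements, with equality exactly for
    the neighbourhoods of C_5.  One unit per consecutive pair pays for the
    additional elements, the other one for not being such a
    neighbourhood. *)
Lemma pentagon_pair_free (S : 'I_5 -> bool) :
  ~~ [exists i, [forall a, S a == consec i a]] + \sum_a S a
    <= 2 + 2 * \sum_a (S a && S (ordS a)).
Proof.
rewrite exists5 !forall5 !sum5 !ordS5.
by case: (S o0); case: (S o1); case: (S o2); case: (S o3); case: (S o4).
Qed.

Lemma pentagon_independent (S : 'I_5 -> bool) :
  (forall c, ~~ (S c && S (ordS c))) -> exists i, forall c, S c -> consec i c.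
Proof.
move=> H.
have /existsP [i /forallP Hi] : [exists i, [forall c, S c ==> consec i c]].
  move: (H o0) (H o1) (H o2) (H o3) (H o4); rewrite exists5 !forall5 !ordS5.
  by case: (S o0); case: (S o1); case: (S o2); case: (S o3); case: (S o4).
by exists i => c; apply/implyP.
Qed.

(** The chord at [a] joins [a] and [a + 2], so the chords form again a 5-cycle,
    the pentagram, in which three edges always contain two that meet. *)
Lemma pentagon_adjacent_chords (S : 'I_5 -> bool) :
  2 < \sum_a S a -> exists a, S a && S (ordS (ordS a)).
Proof.
move=> S3; apply/existsP; move: S3; rewrite exists5 sum5 !ordS5.
by case: (S o0); case: (S o1); case: (S o2); case: (S o3); case: (S o4).
Qed.

(** Five steps +1 or -1 have an odd sum, so the walk closes up mod 5 only if the
    sum is 5 or -5: all steps have the same direction and every edge of C_5 is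
    used. *)
Lemma pentagon_walk (h : 'I_5 -> 'I_5) :
  (forall a, consec (h a) (h (ordS a))) ->
  forall i, exists a b, h a = i /\ h (step b a) = ordS i.
Proof.
move=> H i.
suff /existsP [a /andP [/eqP ha /orP [] /eqP hb]] : [exists a,
    (h a == i) && ((h (ordS a) == ordS i) || (h (ord_pred a) == ordS i))].
- by exists a, true.
- by exists a, false.
move: (H o0) (H o1) (H o2) (H o3) (H o4); rewrite exists5 !ordS5 !ord_pred5.
move: (h o0) (h o1) (h o2) (h o3) (h o4) => x0 x1 x2 x3 x4.
elim/ord5_ind: x0; elim/ord5_ind: x1 => //; elim/ord5_ind: x2 => //;
  elim/ord5_ind: x3 => //; elim/ord5_ind: x4 => //; by elim/ord5_ind: i.
Qed.

(** * Arithmetic *)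

Lemma sum_floor a b m c : m ^ 2 <= a * b + c * m -> (c + 1) ^ 2 < 4 * m ->
  2 * m <= a + b + c.
Proof.
move=> H cm; rewrite leqNgt; apply/negP => lt2m.
(* If [a + b + c < 2 * m], then [4 * a * b <= t ^ 2 = 4 * m ^ 2 - 4 * (c + 1) * m
   + (c + 1) ^ 2], which is less than [4 * m ^ 2 - 4 * c * m]. *)
pose t := 2 * m - (c + 1); have Et : 2 * m = t + (c + 1) by lia.
have H1 : (a + b) * (a + b) <= t * t by apply: leq_mul; lia.
have H2 := (nat_AGM2 a b).1.
have H3 : (2 * m) * (2 * m) = t * t + 2 * (t * (c + 1)) + (c + 1) * (c + 1).
  by rewrite Et; lia.
have H4 : (t + (c + 1)) * (c + 1) = 2 * m * (c + 1) by rewrite -Et.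
move: H cm H2; rewrite -!mulnn; lia.
Qed.

(** Each [a i] is the total minus two sums of consecutive terms, which
    [sum_floor] bounds from below; this gives the upper bound, and the upper bound
    on a neighbouring term gives the lower one. *)
Lemma class_sizes (a : 'I_5 -> nat) m c :
  \sum_i a i <= 5 * m + 4 -> (forall i, m ^ 2 <= a i * a (ordS i) + c * m) ->
  (c + 1) ^ 2 < 4 * m ->
  forall i, m <= a i + (3 * c + 4) /\ a i <= m + (2 * c + 4).
Proof.
move=> sa Ha cm i; have S j := sum_floor (Ha j) cm.
move: sa (S o0) (S o1) (S o2) (S o3) (S o4); rewrite sum5 !ordS5.
by elim/ord5_ind: i; lia.
Qed.

(** Solves the inequality that [card_kept_stray] gives for the number [y] of pairs:
    to leading order it reads [y * m <= 4 * m ^ 2 + (12 / (100 * p)) * y * m], and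
    the factor [100 * p] makes the error term smaller than [m / p]. *)
Lemma stray_arith p m D E y : 2 <= p ->
  y * (100 * p * m) <= 100 * p * (4 * m ^ 2 + E * m)
    + y * (12 * m + 100 * p * (D + 2)) ->
  (4 * p + 1) * 3 * (D + 2) + 3 * p * E < m ->
  p * y <= (4 * p + 1) * m.
Proof.
move=> p2 H mbig; rewrite leqNgt; apply/negP => ylt.
have m0 : 0 < m by lia.
have A0 : 12 * m + 100 * p * (D + 2) <= 100 * p * m by nia.
pose A := 100 * p * m - (12 * m + 100 * p * (D + 2)).
have EA : A + (12 * m + 100 * p * (D + 2)) = 100 * p * m by rewrite subnK.
have H1 : y * A <= 100 * p * (4 * m ^ 2 + E * m).
  by move: H; rewrite -EA mulnDr leq_add2r.
have H2 : (4 * p + 1) * m * A <= p * (100 * p * (4 * m ^ 2 + E * m)).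
  apply: (@leq_trans (p * (y * A))); last by rewrite leq_mul2l H1 orbT.
  by rewrite mulnA leq_mul2r (ltnW ylt) orbT.
have H3 : (4 * p + 1) * A <= 100 * p * p * (4 * m + E).
  by rewrite -(leq_pmul2r m0); move: H2; rewrite -mulnn; lia.
have H4 : (4 * p + 1) * (A + (12 * m + 100 * p * (D + 2))) =
    (4 * p + 1) * (100 * p * m) by rewrite EA.
have H5 : 2 * m <= p * m by rewrite leq_mul2r p2 orbT.
have : p * (46 * m) <= p * ((4 * p + 1) * (100 * (D + 2)) + 100 * p * E).
  by move: H3 H4; clearbody A; lia.
by rewrite leq_pmul2l; lia.
Qed.

(** * Graphs decomposed into pentagons *)

Section Pentagons.
Variables (T : finType) (k : nat) (f : 'I_k -> 'I_5 -> T).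

(** An edge of a pentagon with a direction: the pentagon, the position of the
    source, and whether it is traversed forwards.  Darts correspond one to one
    to ordered adjacent pairs, and a dart determines a cherry, by continuing one
    step along its pentagon. *)
Definition dart : finType := ('I_k * 'I_5 * bool)%type.
Implicit Types (d : dart) (u v w x : T) (j : 'I_k) (a i : 'I_5).

Definition src d := f d.1.1 d.1.2.
Definition dst d := f d.1.1 (step d.2 d.1.2).
Definition nxt d := f d.1.1 (step d.2 (step d.2 d.1.2)).

Definition adj u v := [exists d : dart, (src d == u) && (dst d == v)].
Definition cherry u v w :=
  [exists d : dart, [&& src d == u, dst d == v & nxt d == w]].

Definition deg v := #|[set w | adj v w]|.
Definition codeg u v := #|[set w | adj u w && adj v w]|.

(** By [dart_inj] the pentagons are edge-disjoint; [triangle_cherry] says that no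
    triangle is multicolored. *)
Hypothesis f_inj : forall j, injective (f j).
Hypothesis dart_inj : injective (fun d : dart => (src d, dst d)).
Hypothesis triangle_cherry : forall u v w,
  adj u v -> adj v w -> adj u w ->
  [|| cherry u v w, cherry v w u | cherry w u v].

Lemma adjP u v : reflect (exists d, src d = u /\ dst d = v) (adj u v).
Proof.
apply: (iffP existsP) => -[d].
  by case/andP=> /eqP <- /eqP <-; exists d.
by case=> <- <-; exists d; rewrite !eqxx.
Qed.

Lemma cherryP u v w :
  reflect (exists d, [/\ src d = u, dst d = v & nxt d = w]) (cherry u v w).
Proof.
apply: (iffP existsP) => -[d].
  by case/and3P=> /eqP <- /eqP <- /eqP <-; exists d.
by case=> <- <- <-; exists d; rewrite !eqxx.
Qed.

Lemma adj_dart d : adj (src d) (dst d).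
Proof. by apply/adjP; exists d. Qed.

Lemma adj_step j a b : adj (f j a) (f j (step b a)).
Proof. exact: (adj_dart (j, a, b)). Qed.

Lemma adjC u v : adj u v = adj v u.
Proof.
suff K x y : adj x y -> adj y x by apply/idP/idP; apply: K.
case/adjP=> [[[j a] b]] [<- <-].
by have := adj_step j (step b a) (~~ b); rewrite stepK.
Qed.

Lemma adj_irr u : adj u u = false.
Proof.
apply/adjP => -[[[j a] b]] [<-] /f_inj /= eq_a.
by have := step_neq b a; rewrite eq_a eqxx.
Qed.

Lemma cherryC u v w : cherry u v w = cherry w v u.
Proof.
suff K x y z : cherry x y z -> cherry z y x by apply/idP/idP; apply: K.
case/cherryP=> [[[j a] b]] [<- <- <-].
apply/cherryP; exists (j, step b (step b a), ~~ b).
by rewrite /src /dst /nxt /= !stepK.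
Qed.

(** The edge [u v] lies in one pentagon only, which leaves [v] in one way. *)
Lemma cherry_uniq u v w w' : cherry u v w -> cherry u v w' -> w = w'.
Proof.
case/cherryP=> d [<- <- <-] /cherryP [d' [Eu Ev <-]].
by congr nxt; apply: dart_inj; rewrite Eu Ev.
Qed.

Lemma dart_cycle_inj j j' a a' b b' :
  f j a = f j' a' -> f j (step b a) = f j' (step b' a') -> j = j'.
Proof.
move=> Ea Eb; suff [-> //] : (j, a, b) = (j', a', b').
by apply: dart_inj; congr pair.
Qed.

Lemma sum_adj (G : T -> T -> nat) :
  \sum_u \sum_(v | adj u v) G u v = \sum_(d : dart) G (src d) (dst d).
Proof.
rewrite pair_big_dep /=.
rewrite -(@big_imset _ _ _ _ _ (fun d : dart => (src d, dst d)) predT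
           (fun p => G p.1 p.2)) /=; last by move=> ? ? _ _; apply: dart_inj.
apply: eq_bigl => -[u v] /=; apply/adjP/imsetP => -[d].
  by case=> <- <-; exists d.
by move=> _ [-> ->]; exists d.
Qed.

Lemma sum_dart (H : dart -> nat) :
  \sum_d H d = \sum_j \sum_a (H (j, a, true) + H (j, a, false)).
Proof.
rewrite pair_bigA /=.
rewrite (eq_bigr (fun p => \sum_(b : bool) H (p, b))).
  by rewrite pair_bigA /=; apply: eq_bigr => -[[j a] b].
by move=> [j a] _ /=; rewrite big_bool.
Qed.

Lemma sum_sym_dart (G : T -> T -> nat) : (forall u v, G u v = G v u) ->
  \sum_(d : dart) G (src d) (dst d) =
    2 * \sum_j \sum_a G (f j a) (f j (ordS a)).
Proof.
move=> GC; rewrite sum_dart big_distrr /=; apply: eq_bigr => j _.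
rewrite big_split mul2n -addnn; congr (_ + _).
rewrite (reindex_inj (@ordS_inj 5)); apply: eq_bigr => a _.
by rewrite /src /dst /= ordSK.
Qed.

Lemma sum_src (G : T -> nat) :
  \sum_(d : dart) G (src d) = 2 * \sum_j \sum_a G (f j a).
Proof.
rewrite sum_dart big_distrr /=; apply: eq_bigr => j _.
by rewrite big_split mul2n -addnn.
Qed.

Lemma card_dart : #|dart| = 10 * k.
Proof. by rewrite !card_prod !card_ord card_bool -mulnA mulnC. Qed.

Lemma sum_deg : \sum_v deg v = 10 * k.
Proof.
rewrite -card_dart -sum1_card -(sum_adj (fun _ _ => 1)).
by apply: eq_bigr => u _; rewrite sum1dep_card.
Qed.

Definition triangles v :=
  [set p : T * T | [&& adj v p.1, adj v p.2 & adj p.1 p.2]].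

(** Each edge at [v] lies in at most one triangle for each of the three positions
    of the cherry in the triangle. *)
Lemma card_triangles v : #|triangles v| <= 3 * deg v.
Proof.
have K (A : {set T * T}) (s : bool)
    (r := fun p : T * T => if s then p.1 else p.2) :
    (forall p, p \in A -> adj v (r p)) ->
    (forall p p', p \in A -> p' \in A -> r p = r p' -> p = p') ->
    #|A| <= deg v.
  move=> Av Ainj; rewrite -(@card_in_imset _ _ r) //.
  by apply/subset_leq_card/subsetP => _ /imsetP [p /Av rv ->]; rewrite inE.
pose A1 := [set p : T * T | adj v p.1 && cherry v p.1 p.2].
pose A2 := [set p : T * T | adj v p.2 && cherry v p.2 p.1].
pose A3 := [set p : T * T | adj v p.1 && cherry p.1 v p.2].
apply: (@leq_trans #|A1 :|: A2 :|: A3|).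
  apply/subset_leq_card/subsetP => -[x y]; rewrite !inE /= => /and3P [vx vy xy].
  rewrite vx vy /=; have := triangle_cherry vx xy vy.
  by rewrite (cherryC x y v) (cherryC y v x) orbA.
rewrite !mulSn addn0 addnA (leq_trans (leq_card_setU _ _)) //.
apply: leq_add; first rewrite (leq_trans (leq_card_setU _ _)) // leq_add //.
- apply: (K _ true) => [p|[x y] [x' y']]; first by rewrite inE => /andP [].
  rewrite !inE /= => /andP [_ c] /andP [_ c'] eq_x; subst x'.
  by rewrite (cherry_uniq c c').
- apply: (K _ false) => [p|[x y] [x' y']]; first by rewrite inE => /andP [].
  rewrite !inE /= => /andP [_ c] /andP [_ c'] eq_x; subst y'.
  by rewrite (cherry_uniq c c').
- apply: (K _ true) => [p|[x y] [x' y']]; first by rewrite inE => /andP [].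
  rewrite !inE /= => /andP [_ c] /andP [_ c'] eq_x; subst x'.
  by rewrite (cherry_uniq c c').
Qed.

Lemma sum_codeg : \sum_j \sum_a codeg (f j a) (f j (ordS a)) <= 15 * k.
Proof.
rewrite -(leq_pmul2l (isT : 0 < 2)) -sum_sym_dart => [|u v]; last first.
  by congr #|pred_of_set _|; apply/setP => w; rewrite !inE andbC.
rewrite -sum_adj.
have -> : \sum_u \sum_(v | adj u v) codeg u v = \sum_w #|triangles w|.
  under eq_bigr => u _ do under eq_bigr => v _ do rewrite /codeg -sum1dep_card.
  under [RHS]eq_bigr => w _.
    rewrite -sum1dep_card big_mkcond /= -(pair_bigA _ (fun u v =>
      if [&& adj w u, adj w v & adj u v] then 1 else 0)) /=; over.
  rewrite /= [RHS]exchange_big; apply: eq_bigr => u _ /=.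
  rewrite [RHS]exchange_big big_mkcond; apply: eq_bigr => v _ /=.
  rewrite big_mkcond /=; case: ifP => uv; last first.
    by rewrite big1 // => w _; rewrite andbF /= andbF.
  by apply: eq_bigr => w _; rewrite andbT (adjC w u) (adjC w v).
apply: (@leq_trans (\sum_w 3 * deg w)).
  by apply: leq_sum => w _; exact: card_triangles.
by rewrite -big_distrr /= sum_deg !mulnA.
Qed.

Definition typical j v := [exists i, [forall a, adj v (f j a) == consec i a]].

(** The degrees of the five vertices of a pentagon sum to about [2 * #|T|] at
    most; every atypical vertex lowers the sum, and
    triangles on its sides are the only source of an excess. *)
Lemma leq_atypical_deg j :
  #|[set v | ~~ typical j v]| + \sum_a deg (f j a) <=
    2 * #|T| + 2 * \sum_a codeg (f j a) (f j (ordS a)).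
Proof.
rewrite -sum1dep_card big_mkcond /=.
have -> : \sum_a deg (f j a) = \sum_v \sum_a adj v (f j a).
  rewrite exchange_big; apply: eq_bigr => a _.
  rewrite /deg -sum1dep_card big_mkcond; apply: eq_bigr => v _.
  by rewrite adjC; case: (adj _ _).
have -> : \sum_a codeg (f j a) (f j (ordS a)) =
    \sum_v \sum_a (adj v (f j a) && adj v (f j (ordS a))).
  rewrite exchange_big; apply: eq_bigr => a _.
  rewrite /codeg -sum1dep_card big_mkcond; apply: eq_bigr => v _.
  by rewrite !(adjC v); case: (_ && _).
have -> : 2 * #|T| = \sum_(v : T) 2 by rewrite sum_nat_const mulnC.
rewrite big_distrr -!big_split /=; apply: leq_sum => v _.
apply: leq_trans (pentagon_pair_free (fun a => adj v (f j a))).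
by rewrite leq_add2r /typical; case: [exists i, _].
Qed.

Lemma sum_sqr_deg : (10 * k) ^ 2 <= #|T| * \sum_v deg v ^ 2.
Proof.
rewrite -sum_deg -(leq_pmul2l (isT : 0 < 2)).
have -> : 2 * (\sum_v deg v) ^ 2 = \sum_u \sum_v 2 * (deg u * deg v).
  rewrite -mulnn big_distrl big_distrr /=; apply: eq_bigr => u _.
  by rewrite !big_distrr.
have -> : 2 * (#|T| * \sum_v deg v ^ 2) =
    \sum_u \sum_v (deg u ^ 2 + deg v ^ 2).
  under [RHS]eq_bigr => u _ do rewrite big_split /= sum_nat_const.
  by rewrite big_split /= -big_distrr /= sum_nat_const mul2n addnn.
by apply: leq_sum => u _; apply: leq_sum => v _; rewrite (nat_Cauchy _ _).1.
Qed.

Lemma sum_deg_cycles : 2 * \sum_j \sum_a deg (f j a) = \sum_v deg v ^ 2.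
Proof.
rewrite -sum_src -(sum_adj (fun u _ => deg u)); apply: eq_bigr => u _.
by rewrite sum_nat_cond_const mulnn.
Qed.

(** Averaging [leq_atypical_deg] over all pentagons, where the degree sums total
    [(\sum_v deg v ^ 2) / 2 >= 50 * k ^ 2 / #|T|]: with [n = #|T|], the mean
    number of atypical vertices is at most [2 * n + 30 - 50 * k / n], which is below 48
    as [n <= 5 * m + 4] and [m ^ 2 <= k]. *)
Lemma exists_typical_cycle m : m ^ 2 <= k -> 5 * m <= #|T| <= 5 * m + 4 ->
  32 <= m -> exists j, #|[set v | ~~ typical j v]| <= 47.
Proof.
move=> mk /andP [nm1 nm2] m32; apply/existsP/existsPn => H.
have k0 : 0 < k by apply: leq_trans mk; rewrite expn_gt0; lia.
have S1 : \sum_j #|[set v | ~~ typical j v]| + \sum_j \sum_a deg (f j a) <=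
    k * (2 * #|T|) + 2 * \sum_j \sum_a codeg (f j a) (f j (ordS a)).
  have -> : k * (2 * #|T|) = \sum_(j : 'I_k) 2 * #|T|.
    by rewrite sum_nat_const card_ord.
  rewrite big_distrr -!big_split; apply: leq_sum => j _.
  exact: leq_atypical_deg.
have S2 : 48 * k <= \sum_j #|[set v | ~~ typical j v]|.
  have -> : 48 * k = \sum_(j : 'I_k) 48 by rewrite sum_nat_const card_ord mulnC.
  by apply: leq_sum => j _; rewrite ltnNge; exact: H.
have := sum_codeg; have := sum_sqr_deg; rewrite -sum_deg_cycles.
set S := \sum_j \sum_a deg _ in S1 *; set C := \sum_j \sum_a codeg _ _ in S1 *.
set n := #|T| in nm1 nm2 S1 *.
move=> Hsq HC.
have {S1 S2 HC} HS : 18 * k + S <= 2 * (k * n) by lia.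
have H1 : n * (18 * k) + 50 * k * k <= 2 * (k * n) * n by nia.
have {H1} H1 : 18 * n + 50 * k <= 2 * n * n.
  rewrite -(leq_pmul2l k0); move: H1; lia.
nia.
Qed.

(** * Stray edges of a partition into five classes *)

Section Classes.
Variable g : T -> 'I_5.

Definition stray_count :=
  \sum_j \sum_a ~~ consec (g (f j a)) (g (f j (ordS a))).
Definition stray_pairs :=
  [set p : T * T | adj p.1 p.2 && ~~ consec (g p.1) (g p.2)].
Definition stray_cycles :=
  [set j | [exists a, ~~ consec (g (f j a)) (g (f j (ordS a)))]].
Definition part i := [set v | g v == i].
Definition links i :=
  [set p : T * T | [&& g p.1 == i, g p.2 == ordS i & adj p.1 p.2]].
Definition gaps i :=
  [set p : T * T | [&& g p.1 == i, g p.2 == ordS i & ~~ adj p.1 p.2]].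

Lemma card_stray_pairs : #|stray_pairs| = 2 * stray_count.
Proof.
rewrite -(sum_sym_dart (G := fun u v => ~~ consec (g u) (g v))); last first.
  by move=> u v; rewrite consecC.
rewrite -(sum_adj (fun u v => ~~ consec (g u) (g v))) pair_big_dep /=.
rewrite /stray_pairs -sum1dep_card big_mkcondr /=.
by apply: eq_bigr => p _; case: consec.
Qed.

Lemma card_stray_cycles : #|stray_cycles| <= stray_count.
Proof.
rewrite -sum1dep_card big_mkcond; apply: leq_sum => j _.
by case: existsP => // -[a Ha]; rewrite (bigD1 a) //= Ha.
Qed.

Lemma not_stray j a b : j \notin stray_cycles ->
  consec (g (f j a)) (g (f j (step b a))).
Proof.
rewrite inE => /existsPn H; case: b; first by have := H a; rewrite negbK.
by have := H (ord_pred a); rewrite negbK ord_predK consecC.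
Qed.

(** A pentagon without stray edges has an edge between classes [i] and [i + 1] by
    [pentagon_walk], and different pentagons have different ones. *)
Lemma leq_links i : k <= #|links i| + stray_count.
Proof.
rewrite -[X in X <= _](card_ord k) -(cardsC stray_cycles) addnC.
rewrite leq_add ?card_stray_cycles //.
pose r j (p : T * T) := [exists a, exists b, (f j a, f j (step b a)) == p].
apply: (leq_card_rel (r := r)) => [j|j j' p].
  rewrite inE => Hj.
  have [a [b [Ea Eb]]] := pentagon_walk (fun a => not_stray a true Hj) i.
  exists (f j a, f j (step b a)).
    by rewrite inE /= Ea Eb !eqxx adj_step.
  by apply/existsP; exists a; apply/existsP; exists b.
move=> /existsP [a /existsP [b /eqP <-]] /existsP [a' /existsP [b' /eqP [E1 E2]]].
exact: (esym (dart_cycle_inj E1 E2)).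
Qed.

Lemma card_links_gaps i : #|links i| + #|gaps i| = #|part i| * #|part (ordS i)|.
Proof.
rewrite -cardsX -[RHS](cardsID [set p | adj p.1 p.2]).
congr (_ + _); apply: eq_card => p; rewrite !inE;
  by case: (_ == i); case: (_ == ordS i); case: adj.
Qed.

Lemma sum_card_part : \sum_i #|part i| = #|T|.
Proof.
rewrite -sum1_card (partition_big g xpredT) //.
by apply: eq_bigr => i _; rewrite sum1dep_card.
Qed.

(** * Chords of the pentagons *)

Definition chords j := \sum_a adj (f j a) (f j (ordS (ordS a))).
Definition crowded := [set j | 2 < chords j].

Lemma cherry_in_cycle j a b w :
  cherry (f j a) (f j (step b a)) w -> w = f j (step b (step b a)).
Proof.
by move/cherry_uniq; apply; apply/cherryP; exists (j, a, b).
Qed.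

(** Two chords that meet at [x] span with a side [u w] of the pentagon a triangle,
    so they are consecutive edges of another pentagon: the other two possible
    cherries contain [u w], and that edge is continued in its pentagon by a side
    and not by a chord. *)
Lemma crowded_cherry j : j \in crowded ->
  exists d a, [/\ src d = f j a & nxt d = f j (ord_pred a)].
Proof.
rewrite inE => /pentagon_adjacent_chords [a /andP [c1 c2]].
pose u := f j a; pose x := f j (ordS (ordS a)); pose w := f j (ord_pred a).
have ux : adj u x by [].
have xw : adj x w.
  move: c2; rewrite /x /w; congr (adj _ (f j _)).
  by elim/ord5_ind: a {c1 u x w ux}; apply: val_inj.
have uw : adj u w by exact: (adj_step j a false).
case/or3P: (triangle_cherry ux xw uw).
- by move=> /cherryP [d [Eu _ Ew]]; exists d, a.
- rewrite cherryC => /(cherry_in_cycle (b := false)) /f_inj.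
  by elim/ord5_ind: a {c1 c2 u x w ux xw uw}.
- rewrite -[u](congr1 (f j) (ord_predK a)).
  move=> /(cherry_in_cycle (b := true)) /f_inj.
  by elim/ord5_ind: a {c1 c2 u x w ux xw uw}.
Qed.

(** The cherry of [crowded_cherry] closes to a triangle, so [j] or the pentagon of
    the cherry contains a stray edge.  In the second case the cherry determines
    [j], and a pentagon has ten directed cherries. *)
Lemma card_crowded : #|crowded| <= 11 * stray_count.
Proof.
pose D := [set d : dart | d.1.1 \in stray_cycles].
have cD : #|D| = #|stray_cycles| * 10.
  transitivity #|setX (setX stray_cycles [set: 'I_5]) [set: bool]|.
    by apply: eq_card => -[[j a] b]; rewrite !inE !andbT.
  by rewrite !cardsX !cardsT card_ord card_bool -mulnA.
pose r j d := [exists a, (src d, nxt d) == (f j a, f j (ord_pred a))].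
have c1 : #|crowded :\: stray_cycles| <= #|D|.
  apply: (leq_card_rel (r := r)) => [j|j j' d].
    rewrite inE => /andP [sj /crowded_cherry [d [a [Es En]]]].
    exists d; last by apply/existsP; exists a; rewrite Es En.
    rewrite inE; apply/negPn/negP => sd.
    have c1 := not_stray d.1.2 d.2 sd.
    have c2 := not_stray (step d.2 d.1.2) d.2 sd.
    have /negP := consec_triangle_free c1 c2; apply.
    rewrite -/(src d) -/(nxt d) Es En; exact: (not_stray a false sj).
  move=> /existsP [a /eqP [Es En]] /existsP [a' /eqP []]; rewrite Es En.
  exact: (@dart_cycle_inj _ _ _ _ false false).
have c2 : #|crowded| <= #|stray_cycles| + #|crowded :\: stray_cycles|.
  rewrite -(cardsID stray_cycles crowded) leq_add2r.
  by apply/subset_leq_card/subsetP => j; rewrite inE => /andP [].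
by have := card_stray_cycles; lia.
Qed.

Lemma sum_chords : \sum_j chords j <= 2 * k + 33 * stray_count.
Proof.
have H j : chords j <= 2 + 3 * (j \in crowded).
  rewrite inE; case: ltnP => //= _; rewrite /chords sum5.
  by do 5!case: (adj _ _).
apply: (@leq_trans (\sum_j (2 + 3 * (j \in crowded)))); first exact: leq_sum.
rewrite big_split sum_nat_const card_ord mulnC leq_add2l -big_distrr /=.
have -> : \sum_j (j \in crowded) = #|crowded|.
  by rewrite -sum1_card [RHS]big_mkcond.
by have := card_crowded; lia.
Qed.

Lemma sum_closed_cherries :
  \sum_(d : dart) adj (src d) (nxt d) <= 4 * k + 66 * stray_count.
Proof.
have -> : \sum_(d : dart) adj (src d) (nxt d) = 2 * \sum_j chords j.
  rewrite sum_dart big_distrr /=; apply: eq_bigr => j _.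
  rewrite big_split mul2n -addnn; congr (_ + _).
  rewrite (reindex_inj (inj_comp (@ordS_inj 5) (@ordS_inj 5))) /=.
  by apply: eq_bigr => a _; rewrite /src /nxt /= !ordSK adjC.
by have := sum_chords; lia.
Qed.

Definition cherries u v := #|[set x | cherry u x v]|.

(** A triangle on [u v] whose cherry uses the edge [u v] itself has its third
    vertex next to [u v] in the pentagon of this edge. *)
Lemma codeg_cherries u v : adj u v -> codeg u v <= 2 + cherries u v.
Proof.
move=> uv; pose A1 := [set x | cherry u v x]; pose A2 := [set x | cherry v u x].
have c1 : #|A1| <= 1.
  by apply/card_le1_eqP => x y; rewrite !inE => c c'; rewrite (cherry_uniq c c').
have c2 : #|A2| <= 1.
  by apply/card_le1_eqP => x y; rewrite !inE => c c'; rewrite (cherry_uniq c c').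
apply: (@leq_trans #|A1 :|: A2 :|: [set x | cherry u x v]|).
  apply/subset_leq_card/subsetP => x; rewrite !inE => /andP [ux vx].
  have := triangle_cherry uv vx ux; rewrite (cherryC x u v) (cherryC v x u).
  by case/or3P => ->; rewrite ?orbT.
have := leq_card_setU (A1 :|: A2) [set x | cherry u x v].
have := leq_card_setU A1 A2; rewrite /cherries.
by move=> [H1 _] [H2 _]; lia.
Qed.

(** Each cherry [u x v] closed by an edge [u v] is a pair of adjacent vertices at
    distance two on a pentagon, so the closed cherries are counted by chords. *)
Lemma sum_cherries (P : {set T * T}) : (forall p, p \in P -> adj p.1 p.2) ->
  \sum_(p in P) cherries p.1 p.2 <= 4 * k + 66 * stray_count.
Proof.
move=> Padj; apply: leq_trans sum_closed_cherries.
rewrite (sum_card_fibres (fun p => p \in P) (fun p x => cherry p.1 x p.2)).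
have -> : \sum_(d : dart) adj (src d) (nxt d) =
    #|[set d : dart | adj (src d) (nxt d)]|.
  by rewrite -sum1dep_card [RHS]big_mkcond.
pose r (q : T * T * T) d := [&& src d == q.1.1, dst d == q.2 & nxt d == q.1.2].
apply: (leq_card_rel (r := r)) => [[[u v] x]|[[u v] x] [[u' v'] x'] d].
  rewrite inE /= => /andP [/Padj uv /cherryP [d [Eu Ex Ev]]].
  by exists d; rewrite ?inE /r ?Eu ?Ex ?Ev ?eqxx.
by move=> /and3P [/= /eqP <- /eqP <- /eqP <-] /and3P [/= /eqP <- /eqP <- /eqP <-].
Qed.

(** * Missing pairs *)

Definition missing v := #|[set w | consec (g v) (g w) && ~~ adj v w]|.
Definition nb_in v c := #|[set w | adj v w && (g w == c)]|.

Lemma sum_missing M : (forall i, #|gaps i| <= M) -> \sum_v missing v <= 10 * M.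
Proof.
move=> gM.
rewrite (sum_card_fibres xpredT (fun v w => consec (g v) (g w) && ~~ adj v w)).
pose A := [set p : T * T | (g p.2 == ordS (g p.1)) && ~~ adj p.1 p.2].
have cA : #|A| <= 5 * M.
  rewrite -sum1dep_card (partition_big (fun p => g p.1) xpredT) //=.
  apply: (@leq_trans (\sum_(i < 5) M)); last by rewrite sum_nat_const card_ord.
  apply: leq_sum => i _; rewrite sum1dep_card; apply: leq_trans (gM i).
  apply/subset_leq_card/subsetP => p; rewrite !inE => /andP [/andP [/eqP -> ->]].
  by move=> /eqP ->; rewrite !eqxx.
pose s (p : T * T) := (p.2, p.1).
apply: (@leq_trans #|A :|: s @: A|).
  apply/subset_leq_card/subsetP => -[u v]; rewrite !inE /=.
  move=> /andP [/orP [->->//|uv nuv]].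
  by apply/orP; right; apply/imsetP; exists (v, u); rewrite // inE /= uv adjC.
by have [] := leq_card_setU A (s @: A); have := leq_imset_card s A; lia.
Qed.

(** Adjacent pairs between the two neighbourhoods are triangles at [v]. *)
Lemma leq_nb_in_consec v c :
  nb_in v c * nb_in v (ordS c) <= 3 * deg v + #|gaps c|.
Proof.
rewrite -cardsX -(cardsID (triangles v)).
apply: leq_add.
  apply: leq_trans (card_triangles v).
  by apply/subset_leq_card/subsetP => p; rewrite inE => /andP [].
apply/subset_leq_card/subsetP => p; rewrite !inE.
move=> /andP [H /andP [/andP [v1 ->] /andP [v2 ->]]] /=.
by move: H; rewrite v1 v2.
Qed.

(** If [v] had more than [#|T| / r] neighbours in two consecutive classes, there
    would be more pairs between them than triangles at [v] and gaps allow. So the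
    classes with many neighbours of [v] are independent in C_5, hence lie around
    one class [i]. *)
Lemma home_class M r v : (forall i, #|gaps i| <= M) ->
  r ^ 2 * (3 * #|T| + M) < #|T| ^ 2 ->
  exists i, forall c, ~~ consec i c -> r * nb_in v c <= #|T|.
Proof.
move=> gM rn.
have [c|i Hi] := @pentagon_independent (fun c => #|T| < r * nb_in v c).
  apply/negP => /andP [c1 c2].
  have := leq_nb_in_consec v c; have := gM c.
  have : deg v <= #|T| by apply: max_card.
  move: rn c1 c2; rewrite -!mulnn.
  set n := #|T|; set x := nb_in v c; set y := nb_in v _; set z := #|gaps c|.
  move=> rn c1 c2 dn zM xy.
  have H1 : n * n <= (r * x) * (r * y) by apply: leq_mul; apply: ltnW.
  have H2 : r * r * (x * y) <= r * r * (3 * n + M) by apply: leq_mul => //; lia.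
  lia.
by exists i => c; apply: contraR; rewrite -ltnNge; exact: Hi.
Qed.

End Classes.

(** * The partition defined by a typical pentagon *)

Lemma first_classes m : m ^ 2 <= k -> 5 * m <= #|T| <= 5 * m + 4 -> 32 <= m ->
  exists g : T -> 'I_5, 2 * stray_count g <= 109 * #|T|.
Proof.
move=> mk nm m32; have [j] := exists_typical_cycle mk nm m32.
set J := [set v | ~~ typical j v] => J47.
pose g v := odflt ord0 [pick i | [forall a, adj v (f j a) == consec i a]].
have gP v : v \notin J -> forall a, adj v (f j a) = consec (g v) a.
  rewrite inE negbK /typical /g => /existsP [i Hi] a.
  case: pickP => [i' /forallP /(_ a) /eqP //|/(_ i)].
  by rewrite Hi.
exists g; rewrite -card_stray_pairs.
pose W := [set p | [exists a, p \in triangles (f j a)]].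
apply: (@leq_trans #|setX J setT :|: setX setT J :|: W|).
  apply/subset_leq_card/subsetP => -[u v]; rewrite !inE /= => /andP [uv nuv].
  case: (boolP (typical j u)) => [su|//].
  case: (boolP (typical j v)) => [sv|//] /=.
  have [a /andP [ua av]] := nonconsec_common nuv.
  apply/existsP; exists a; rewrite inE /= uv !(adjC (f j a)) !gP ?inE ?negbK //.
  by rewrite ua consecC av.
have cW : #|W| <= 15 * #|T|.
  apply: leq_trans (leq_card_exists _) _.
  apply: (@leq_trans (\sum_(a < 5) 3 * #|T|)); last first.
    by rewrite sum_nat_const card_ord mulnA.
  apply: leq_sum => a _; rewrite cardsE.
  apply: leq_trans (card_triangles _) _; rewrite leq_mul2l; exact: max_card.
have := leq_card_setU (setX J setT :|: setX setT J) W.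
have := leq_card_setU (setX J [set: T]) (setX [set: T] J).
by rewrite !cardsX cardsT => -[H1 _] [H2 _]; nia.
Qed.

(** * Moving the exceptional vertices *)

Section Refinement.
Variables (g h : T -> 'I_5) (B : {set T}).

Definition moved v := if v \in B then h v else g v.
Definition kept_stray :=
  [set p in stray_pairs g | (p.1 \notin B) && (p.2 \notin B)].

Lemma stray_at_moved r v : v \in B ->
  (forall c, ~~ consec (h v) c -> r * nb_in g v c <= #|T|) ->
  r * #|[set w | adj v w && ~~ consec (h v) (moved w)]| <= r * #|B| + 3 * #|T|.
Proof.
move=> vB Hr; pose W := [set w | adj v w && ~~ consec (h v) (g w)].
have cW : #|W| = \sum_c ~~ consec (h v) c * nb_in g v c.
  rewrite -sum1dep_card (partition_big g xpredT) //=; apply: eq_bigr => c _.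
  rewrite sum1dep_card; case: (boolP (consec _ c)) => hc.
    by apply/eqP; rewrite cards_eq0; apply/eqP/setP => w; rewrite !inE;
      case: eqP => [->|]; rewrite ?hc ?andbF.
  rewrite mul1n; apply: eq_card => w; rewrite !inE.
  by case: eqP => [->|]; rewrite ?hc ?andbF ?andbT.
have rW : r * #|W| <= 3 * #|T|.
  apply: (@leq_trans (\sum_c ~~ consec (h v) c * #|T|)); last first.
    by rewrite -big_distrl /= sum_nonconsec.
  rewrite cW big_distrr; apply: leq_sum => c _.
  by case: (boolP (consec _ c)) => hc /=; rewrite ?muln0 // !mul1n Hr.
apply: (@leq_trans (r * (#|B| + #|W|))); last by rewrite mulnDr leq_add2l.
rewrite leq_mul2l; apply/orP; right.
apply: leq_trans (leq_card_setU B W).1; apply/subset_leq_card/subsetP => w.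
by rewrite !inE /moved; case: (w \in B).
Qed.

Lemma stray_moved r :
  (forall v c, v \in B -> ~~ consec (h v) c -> r * nb_in g v c <= #|T|) ->
  r * (2 * stray_count moved) <=
    r * #|kept_stray| + 2 * (#|B| * (r * #|B| + 3 * #|T|)).
Proof.
move=> Hr; rewrite -card_stray_pairs.
pose Z := [set p : T * T |
  (p.1 \in B) && (adj p.1 p.2 && ~~ consec (h p.1) (moved p.2))].
pose s (p : T * T) := (p.2, p.1).
have cZ : r * #|Z| <= #|B| * (r * #|B| + 3 * #|T|).
  rewrite -(sum_card_fibres (fun v => v \in B)
    (fun v w => adj v w && ~~ consec (h v) (moved w))).
  rewrite big_distrr -sum_nat_const /=; apply: leq_sum => v vB.
  by apply: stray_at_moved => // c; exact: Hr.
have cU : #|stray_pairs moved| <= #|kept_stray| + #|Z| + #|Z|.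
  apply: (@leq_trans #|kept_stray :|: Z :|: s @: Z|).
    apply/subset_leq_card/subsetP => -[u v]; rewrite !inE /= => /andP [uv].
    rewrite uv /=; case: (boolP (u \in B)) => uB.
      by rewrite {1}/moved uB => ->; rewrite /= orbT.
    case: (boolP (v \in B)) => vB; last first.
      by rewrite /moved (negPf uB) (negPf vB) => ->.
    rewrite consecC {1}/moved vB => c; apply/orP; right.
    by apply/imsetP; exists (v, u); rewrite // inE /= vB adjC uv.
  have := leq_card_setU (kept_stray :|: Z) (s @: Z).
  have := leq_card_setU kept_stray Z; have := leq_imset_card s Z.
  by move=> H0 [H1 _] [H2 _]; lia.
apply: (@leq_trans (r * (#|kept_stray| + #|Z| + #|Z|))).
  by rewrite leq_mul2l cU orbT.
by rewrite !mulnDr; lia.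
Qed.

(** A class [c] is consecutive to those of both [u] and [v].  Apart from the
    vertices missed by [u] or [v], all of [part g c] consists of common neighbours
    of [u] and [v], and all but two of these are centres of cherries over [u v]. *)
Lemma card_kept_stray q s : (forall v, v \notin B -> q * missing g v <= #|T|) ->
  (forall i, s <= #|part g i|) ->
  #|kept_stray| * (q * s) <=
    q * (4 * k + 66 * stray_count g) + #|kept_stray| * (2 * #|T| + 2 * q).
Proof.
move=> Hq Hs.
have Hp p : p \in kept_stray ->
    q * s <= q * cherries p.1 p.2 + (2 * #|T| + 2 * q).
  case: p => u v; rewrite !inE /= => /andP [/andP [uv nuv] /andP [uB vB]].
  have [c /andP [uc cv]] := nonconsec_common nuv.
  have P1 : #|part g c| <= codeg u v + (missing g u + missing g v).
    pose A := [set w | adj u w && adj v w].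
    pose A1 := [set w | consec (g u) (g w) && ~~ adj u w].
    pose A2 := [set w | consec (g v) (g w) && ~~ adj v w].
    apply: (@leq_trans #|A :|: (A1 :|: A2)|).
      apply/subset_leq_card/subsetP => w; rewrite !inE => /eqP ->.
      by rewrite uc (consecC (g v)) cv /=; case: (adj u w); case: (adj v w).
    have := leq_card_setU A (A1 :|: A2); have := leq_card_setU A1 A2.
    by rewrite /codeg /missing -/A -/A1 -/A2 => -[H1 _] [H2 _]; lia.
  have H1 := codeg_cherries uv; have H2 := Hs c; pose n := #|T|.
  have H3 : q * missing g u <= n := Hq u uB.
  have H4 : q * missing g v <= n := Hq v vB.
  have : q * s <= q * (2 + cherries u v + (missing g u + missing g v)).
    by rewrite leq_mul2l; apply/orP; right; lia.
  by rewrite /= !mulnDr -/n; lia.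
apply: (@leq_trans (\sum_(p in kept_stray)
    (q * cherries p.1 p.2 + (2 * #|T| + 2 * q)))).
  by rewrite -sum_nat_const; apply: leq_sum.
rewrite big_split /= sum_nat_const leq_add2r -big_distrr /= leq_mul2l.
apply/orP; right; apply: sum_cherries => p.
by rewrite !inE => /andP [/andP []].
Qed.
End Refinement.

(** The parameters are, in terms of the initial number [C * m] of stray edges:
    [D] bounds the deviation of the class sizes from [m], and [M * m] the gaps
    between two classes; a vertex is moved if it misses a proportion [1 / q] of
    all vertices, which happens at most [b] times; a moved vertex keeps at most
    [#|T| / r] neighbours in each class where they are stray; and [E * m] is the
    lower-order part of the number of closed cherries.  The choice of [r] makes
    the stray edges at moved vertices negligible against [m / p]. *)
Lemma refined_classes g p m C (D := 3 * C + 4) (M := 2 * D + C + 1)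
    (q := 100 * p) (b := 2 * (q * M)) (r := 36 * (p * b))
    (E := 8 * D + 70 * C + 1) :
  2 <= p -> m ^ 2 <= k -> 5 * m <= #|T| <= 5 * m + 4 -> stray_count g <= C * m ->
  4 * D ^ 2 + (C + 1) ^ 2 <= m -> r ^ 2 * (18 + M) < m ->
  2 * (p * b ^ 2) <= m -> (4 * p + 1) * 3 * (D + 2) + 3 * p * E < m ->
  exists g' : T -> 'I_5, 2 * (p * stray_count g') <= (4 * p + 3) * m.
Proof.
move=> p2 mk /andP [nm1 nm2] gC m1 m2 m3 m4.
have m0 : 4 <= m by lia.
have n6 : #|T| <= 6 * m by lia.
have Dm : D <= m.
  have : D * 1 <= D * D by rewrite leq_mul2l /D; lia.
  by rewrite mulnn; clearbody D; lia.
have prod_ge i : m ^ 2 <= #|part g i| * #|part g (ordS i)| + C * m.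
  by have := leq_links g i; have := card_links_gaps g i; lia.
have sizes i : m <= #|part g i| + D /\ #|part g i| <= m + D.
  have [||H1 H2] := @class_sizes (fun i => #|part g i|) m C _ prod_ge _ i.
  - by rewrite sum_card_part.
  - by lia.
  by split=> //; rewrite /D; lia.
have prod_le i : #|part g i| * #|part g (ordS i)| <= m ^ 2 + 2 * D * m + D ^ 2.
  apply: (@leq_trans ((m + D) * (m + D))); last by rewrite mulnn sqrnD; lia.
  by apply: leq_mul; [case: (sizes i) | case: (sizes (ordS i))].
have kC : k <= m ^ 2 + 2 * D * m + D ^ 2 + C * m.
  have := leq_links g ord0; have := card_links_gaps g ord0.
  by have := prod_le ord0; lia.
have gM i : #|gaps g i| <= M * m.
  have := leq_links g i; have := card_links_gaps g i; have := prod_le i.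
  by rewrite /M; lia.
pose B := [set v | #|T| < q * missing g v].
have cB : #|B| <= b.
  have H1 : #|B| * #|T| <= q * \sum_v missing g v.
    rewrite -sum_nat_const big_distrr /=.
    rewrite [X in _ <= X](bigID (fun v => v \in B)) /=.
    apply: leq_trans (leq_addr _ _); apply: leq_sum => v.
    by rewrite inE => /ltnW.
  have H2 : q * \sum_v missing g v <= q * (10 * (M * m)).
    by rewrite leq_mul2l (sum_missing gM) orbT.
  have T0 : 0 < #|T| by lia.
  rewrite -(leq_pmul2r T0); apply: leq_trans H1 _; apply: leq_trans H2 _.
  apply: (@leq_trans (b * (5 * m))); last by rewrite leq_mul2l nm1 orbT.
  by rewrite /b; clearbody q M; lia.
have [h Hh] : exists h : T -> 'I_5,
    forall v c, ~~ consec (h v) c -> r * nb_in g v c <= #|T|.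
  apply: (@fin_all_exists _ (fun=> 'I_5)
    (fun v i => forall c, ~~ consec i c -> r * nb_in g v c <= #|T|)) => v.
  apply: (home_class v gM).
  apply: (@leq_ltn_trans (r ^ 2 * ((18 + M) * m))).
    by rewrite leq_mul2l; apply/orP; right; clearbody M; lia.
  rewrite mulnA -mulnn; apply: (@leq_trans (m * m)).
    by rewrite ltn_mul2r m2 andbT; lia.
  by apply: leq_mul; lia.
exists (moved g h B).
have := @stray_moved g h B r (fun v c _ => Hh v c).
set y := #|kept_stray g B| => Hmoved.
have ym : p * y <= (4 * p + 1) * m.
  apply: (@stray_arith p m D E) => //.
  have Hq v : v \notin B -> q * missing g v <= #|T| by rewrite inE -leqNgt.
  have Hs i : m - D <= #|part g i| by case: (sizes i); lia.
  have := card_kept_stray Hq Hs; rewrite -/y -/q => Hy.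
  have Hm : y * (q * m) = y * (q * (m - D)) + y * (q * D).
    by rewrite -!mulnDr subnK.
  have H1 : q * (4 * k + 66 * stray_count g) <= q * (4 * m ^ 2 + E * m).
    by rewrite leq_mul2l; apply/orP; right; rewrite /E; lia.
  have H2 : y * (2 * #|T| + 2 * q) <= y * (12 * m + 2 * q).
    by rewrite leq_mul2l; apply/orP; right; lia.
  by rewrite Hm; clearbody q; lia.
have r0 : 0 < r by rewrite /r /b /q /M /D; lia.
rewrite -(leq_pmul2l r0).
have H1 : #|B| * (r * #|B| + 3 * #|T|) <= b * (r * b + 18 * m).
  by apply: leq_mul => //; apply: leq_add; [rewrite leq_mul2l cB orbT | lia].
set z := stray_count _ in Hmoved *.
have H2 : p * (r * (2 * z)) <= p * (r * y + 2 * (b * (r * b + 18 * m))).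
  by rewrite leq_mul2l; apply/orP; right; lia.
have H3 : r * (p * y) <= r * ((4 * p + 1) * m) by rewrite leq_mul2l ym orbT.
have H4 : r * (2 * (p * b ^ 2)) <= r * m by rewrite leq_mul2l m3 orbT.
have H5 : r * m = 36 * (p * b) * m by [].
by move: H2 H3 H4 H5; rewrite -mulnn; clearbody r b z y; lia.
Qed.

(** Here [p >= 2] bounds the stray edges by [3 * m], and [class_sizes] for [c = 3]
    gives [3 * 3 + 4 = 13] and [2 * 3 + 4 = 10]. *)
Lemma balanced_classes p m g : 2 <= p -> m ^ 2 <= k -> #|T| <= 5 * m + 4 ->
  4 < m -> 2 * (p * stray_count g) <= (4 * p + 3) * m ->
  forall i, m <= #|part g i| + 13 /\ #|part g i| <= m + 10.
Proof.
move=> p2 mk nm m4 Hs i.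
have s3 : stray_count g <= 3 * m.
  have p0 : 0 < 2 * p by lia.
  rewrite -(leq_pmul2l p0) -mulnA (leq_trans Hs) //.
  by rewrite mulnA leq_mul2r; apply/orP; right; lia.
apply: (@class_sizes (fun i => #|part g i|) m 3); last by lia.
  by rewrite sum_card_part.
by move=> c; have := leq_links g c; have := card_links_gaps g c; lia.
Qed.

End Pentagons.

(** * The blow-up of the pentagon *)

Lemma set2_eq (T : finType) (u v x y : T) : x != y -> [set u; v] = [set x; y] ->
  (u = x /\ v = y) \/ (u = y /\ v = x).
Proof.
move=> xy Euv.
have := set21 u v; have := set22 u v; have := set21 x y; have := set22 x y.
rewrite -{1 2}Euv {3 4}Euv !inE.
case: (eqVneq u x) => [->|ux]; case: (eqVneq v x) => [->|vx];
  rewrite /= ?orbF ?orbT //.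
- by rewrite eq_sym (negPf xy).
- by move=> _ _ /eqP ->; left.
- by move=> _ _ _ /eqP ->; right.
Qed.

(** A graph with a homomorphism [g] to C_5 is triangle-free, so it has no
    multicolored triangle for any decomposition. *)
Lemma blow_up_attains (T : finType) (k : nat) (f : 'I_k -> {ffun 'I_5 -> T})
    (g : T -> 'I_5) :
  (forall j a, g (f j a) = a) ->
  (forall j j' a, f j a = f j' a -> f j (ordS a) = f j' (ordS a) -> j = j') ->
  multicolored_C3_free k (\bigcup_j [set [set f j a; f j (ordS a)] | a : 'I_5]).
Proof.
move=> gf f_edge; set E := \bigcup_j _.
have fS j j' a : f j a != f j' (ordS a).
  apply/eqP => /(congr1 g); rewrite !gf => /esym/eqP.
  by apply/negP; exact: (step_neq true).
have EP e : e \in E -> exists j a, e = [set f j a; f j (ordS a)].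
  by case/bigcupP => j _ /imsetP [a _ ->]; exists j, a.
have Econsec u v : [set u; v] \in E -> consec (g u) (g v).
  move=> /EP [j [a /(set2_eq (fS j j a)) [[-> ->]|[-> ->]]]]; rewrite !gf //.
    by rewrite /consec eqxx.
  by rewrite /consec eqxx orbT.
apply/andP; split.
  by apply/forall_inP => e /EP [j [a ->]]; rewrite cards2 fS.
apply/existsP; exists [ffun j => [set [set f j a; f j (ordS a)] | a : 'I_5]].
apply/andP; split.
  apply/and3P; split.
  - by apply/eqP; apply: eq_bigr => j _; rewrite ffunE.
  - apply/forallP => j; apply/existsP; exists (f j); rewrite ffunE eqxx andbT.
    by apply/injectiveP => a a' /(congr1 g); rewrite !gf.
  apply/forallP => j; apply/forallP => j'; apply/implyP => /eqP jj'.
  rewrite -setI_eq0 -subset0; apply/subsetP => e; rewrite !ffunE inE.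
  move=> /andP [/imsetP [a _ ->] /imsetP [a' _ /(set2_eq (fS j' j' a')) []]].
    case=> E1; have Ea : a = a' by rewrite -(gf j a) E1 gf.
    by subst a' => E2; case: jj'; apply: f_edge E1 E2.
  case=> /(congr1 g) + /(congr1 g); rewrite !gf => -> Ea.
  by have := step2_neq true a'; rewrite /= Ea eqxx.
apply/negP => /existsP [H /and3P [HE /existsP [t /andP [_ /eqP defH]] _]].
have tE (i : 'I_3) : consec (g (t i)) (g (t (ordS i))).
  by apply/Econsec/(subsetP HE); rewrite defH; apply: imset_f.
pose i0 : 'I_3 := ord0.
have := consec_triangle_free (tE i0) (tE (ordS i0)).
have -> : ordS (ordS i0) = ord_pred i0 by apply: val_inj.
by rewrite consecC; have := tE (ord_pred i0); rewrite ord_predK => ->.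
Qed.

(** The vertices used are the pairs of a class [a < 5] and a label below [m],
    encoded as [a * m + label].  The pentagon of [(x, y)] has the labels x, y, x, y,
    x + y mod m in the classes 0, ..., 4; the labels of two consecutive vertices
    determine [x] and [y], so different pentagons have no edge in common. *)
Lemma ex_C5_C3_ge n m : 5 * m <= n -> m ^ 2 <= ex_C5_C3 n.
Proof.
move=> mn; apply: (ex_C5_C3P n).2; case: (posnP m) => [->|m0].
  exact: ex_C5_C3_attains0.
pose lab x y a := nth 0 [:: x; y; x; y; (x + y) %% m] a.
pose x (t : 'I_(m ^ 2)) := t %/ m; pose y (t : 'I_(m ^ 2)) := t %% m.
have x_lt t : x t < m by rewrite ltn_divLR // mulnn.
have y_lt t : y t < m by rewrite ltn_mod.
have lab_lt t (a : 'I_5) : lab (x t) (y t) a < m.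
  by elim/ord5_ind: a; rewrite /lab /= ?x_lt ?y_lt ?ltn_mod.
have f_lt t (a : 'I_5) : a * m + lab (x t) (y t) a < n.
  by have := lab_lt t a; have := ltn_ord a; nia.
pose f t := [ffun a : 'I_5 => Ordinal (f_lt t a)].
pose g (v : 'I_n) : 'I_5 := inord (v %/ m).
have f_lab t a : f t a %% m = lab (x t) (y t) a.
  by rewrite ffunE /= modnMDl modn_small.
apply/existsP; exists (\bigcup_t [set [set f t a; f t (ordS a)] | a : 'I_5]).
apply: (@blow_up_attains _ _ f g) => [t a|t t' a /(congr1 val) E1 /(congr1 val) E2].
  rewrite /g ffunE /= divnMDl // divn_small ?addn0 //.
  by apply: val_inj; rewrite /= inordK.
have {}E1 : lab (x t) (y t) a = lab (x t') (y t') a by rewrite -!f_lab E1.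
have {}E2 : lab (x t) (y t) (ordS a) = lab (x t') (y t') (ordS a).
  by rewrite -!f_lab E2.
suff [Ex Ey] : x t = x t' /\ y t = y t'.
  by apply: val_inj; rewrite /= (divn_eq t m) (divn_eq t' m) -/(x t) -/(y t) Ex Ey.
have modI u v w : u < m -> v < m -> u + w = v + w %[mod m] -> u = v.
  by move=> um vm /eqP; rewrite eqn_modDr !modn_small // => /eqP.
elim/ord5_ind: a E1 E2; rewrite /lab /= => E1 E2; split=> //.
  by rewrite E1 in E2; apply: modI E2.
by rewrite E2 !(addnC (x t')) in E1; apply: modI E1.
Qed.

(** * Decompositions as families of parametrised pentagons *)

Section Encoding.
Variables (T : finType) (k : nat) (E : {set {set T}}).
Variable F : {ffun 'I_k -> {set {set T}}}.
Variable f : 'I_k -> 'I_5 -> T.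
Hypothesis f_inj : forall j, injective (f j).
Hypothesis FE : forall j, F j = [set [set f j a; f j (ordS a)] | a : 'I_5].
Hypothesis F_disj : forall i j, i != j -> [disjoint F i & F j].
Hypothesis defE : E = \bigcup_j F j.

Lemma f_step j a b : f j a != f j (step b a).
Proof. by apply/eqP => /f_inj /esym/eqP; apply/negP; exact: step_neq. Qed.

Lemma dart_edge j a b : [set f j a; f j (step b a)] \in F j.
Proof.
rewrite FE; case: b; first exact: imset_f.
by rewrite setUC -{2}(ord_predK a); exact: imset_f.
Qed.

Lemma edge_dart j u v : [set u; v] \in F j ->
  exists a b, u = f j a /\ v = f j (step b a).
Proof.
rewrite FE => /imsetP [a _ /(set2_eq (f_step j a true))] [[-> ->]|[-> ->]].
  by exists a, true.
by exists (ordS a), false; rewrite /= ordSK.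
Qed.

Lemma same_cycle i j e : e \in F i -> e \in F j -> i = j.
Proof.
move=> ei ej; apply/eqP; apply/negPn/negP => /F_disj /disjointFr /(_ ei).
by rewrite ej.
Qed.

Lemma darts_inj : injective (fun d : dart k => (src f d, dst f d)).
Proof.
case=> [[j a] b] [[j' a'] b'] [Es Ed].
have Ej : j = j'.
  apply: (same_cycle (dart_edge j a b)).
  by rewrite /src /dst /= in Es Ed; rewrite Es Ed dart_edge.
subst j'; move: Es Ed => /f_inj /= <- /f_inj /=.
case: b; case: b' => // /eqP; first by elim/ord5_ind: (a).
by elim/ord5_ind: (a).
Qed.

Lemma adjE u v : adj f u v = ([set u; v] \in E).
Proof.
rewrite defE; apply/adjP/bigcupP => [[[[j a] b]] [<- <-]|[j _]].
  by exists j => //; exact: dart_edge.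
by case/edge_dart=> a [b [-> ->]]; exists (j, a, b).
Qed.

Lemma same_cycle_cherry j u v w : u != w ->
  [set u; v] \in F j -> [set v; w] \in F j -> cherry f u v w.
Proof.
move=> uw /edge_dart [a [b [Eu Ev]]] /edge_dart [a' [b' [Ev' Ew]]].
apply/cherryP; exists (j, a, b); split=> //; rewrite /nxt /= Ew; congr f.
have Ea : a' = step b a by apply: (@f_inj j); rewrite -Ev -Ev'.
case: (eqVneq b' b) => [->|]; first by rewrite Ea.
have [->|Eb] : b' = b \/ b' = ~~ b by case: (b) (b') => [] []; auto.
  by rewrite eqxx.
by move: uw; rewrite Eu Ew Ea Eb stepK eqxx.
Qed.

(** A triangle that is not multicolored has two edges in one [F j]. *)
Lemma cherry_of_triangle u v w : ~~ has_multicolored_C3 E F ->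
  adj f u v -> adj f v w -> adj f u w ->
  [|| cherry f u v w, cherry f v w u | cherry f w u v].
Proof.
move=> nC3; rewrite !adjE => uv vw uw.
have neq x y : [set x; y] \in E -> x != y.
  rewrite -adjE; apply: contraTneq => ->.
  by rewrite adj_irr.
have [nuv nvw nuw] := And3 (neq _ _ uv) (neq _ _ vw) (neq _ _ uw).
pose H := [set [set u; v]; [set v; w]; [set u; w]].
have HE : H \subset E.
  by apply/subsetP => e; rewrite !inE => /orP [/orP [] | ] /eqP ->.
have Hcyc : cycle_copy 3 H.
  pose t := [ffun i : 'I_3 => nth u [:: u; v; w] i].
  apply/existsP; exists t; apply/andP; split.
    apply/injectiveP => -[i lti] [i' lti']; rewrite !ffunE => /= E3.
    apply: val_inj => /=; apply/eqP.
    rewrite -(nth_uniq u (s := [:: u; v; w])) ?E3 //.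
    by rewrite /= !inE negb_or nuv nuw nvw.
  apply/eqP/setP => e; apply/idP/imsetP.
    rewrite !inE => /orP [/orP [] | ] /eqP ->.
    - by exists ord0; rewrite // !ffunE.
    - by exists (ordS ord0); rewrite // !ffunE.
    - by exists ord_max; rewrite // !ffunE setUC.
  case=> -[[|[|[|//]]] lti] _ ->; rewrite !ffunE /= /H !inE ?eqxx ?orbT //.
  by rewrite (setUC [set w]) eqxx !orbT.
have : ~~ multicolored F H.
  by apply: contra nC3 => mH; apply/existsP; exists H; rewrite HE Hcyc.
move=> /forallPn [j]; rewrite -ltnNge => /card_gt1P [e [e' []]].
rewrite !inE => /andP [He Fe] /andP [He' Fe'].
have K x y z : x != z -> [set x; y] \in F j -> [set y; z] \in F j ->
    cherry f x y z.
  exact: same_cycle_cherry.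
have uwC := setUC [set u] [set w].
by case/orP: He Fe => [/orP [] | ] /eqP -> Fe;
   case/orP: He' Fe' => [/orP [] | ] /eqP -> Fe';
   rewrite ?eqxx // => _; apply/or3P;
   [ apply: Or31; apply: K
   | apply: Or33; apply: K; rewrite -?uwC // eq_sym
   | apply: Or31; apply: K
   | apply: Or32; apply: K; rewrite -?uwC // eq_sym
   | apply: Or33; apply: K; rewrite -?uwC // eq_sym
   | apply: Or32; apply: K; rewrite -?uwC // eq_sym ].
Qed.

Lemma card_stray_edges (g : T -> 'I_5) :
  #|E :\: \bigcup_(i < 5) bipartite_between E (part g i) (part g (ordS i))|
    <= stray_count f g.
Proof.
pose S := [set s : 'I_k * 'I_5 |
  ~~ consec (g (f s.1 s.2)) (g (f s.1 (ordS s.2)))].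
have -> : stray_count f g = #|S|.
  rewrite /stray_count pair_bigA -sum1dep_card [RHS]big_mkcond.
  by apply: eq_bigr => s _; case: consec.
apply: (leq_card_rel (r := fun e s => e == [set f s.1 s.2; f s.1 (ordS s.2)])).
  move=> e; rewrite inE => /andP [nb_in eE].
  have := eE; rewrite {1}defE => /bigcupP [j _]; rewrite FE => /imsetP [a _ defe].
  exists (j, a); last by rewrite defe.
  rewrite inE /=; apply: contra nb_in => /orP [] /eqP gS; apply/bigcupP.
    exists (g (f j a)) => //; rewrite inE eE; apply/existsP; exists (f j a).
    rewrite inE eqxx; apply/existsP; exists (f j (ordS a)).
    by rewrite inE gS eqxx defe /=.
  exists (g (f j (ordS a))) => //; rewrite inE eE.
  apply/existsP; exists (f j (ordS a)).
  rewrite inE eqxx; apply/existsP; exists (f j a).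
  by rewrite inE gS eqxx defe setUC /=.
by move=> e e' s /eqP -> /eqP ->.
Qed.
End Encoding.

(** * Extremal graphs *)

Lemma extremal_classes p : 2 <= p ->
  exists m0, forall m (T : finType) (E : {set {set T}}), m0 <= m ->
    5 * m <= #|T| <= 5 * m + 4 -> extremal_multicolored_C3_free E ->
  exists g : T -> 'I_5,
    2 * (p * #|E :\: \bigcup_(i < 5)
                 bipartite_between E (part g i) (part g (ordS i))|)
      <= (4 * p + 3) * m /\
    forall i, m <= #|part g i| + 13 /\ #|part g i| <= m + 10.
Proof.
move=> p2.
(* Half of the bound in [first_classes] is [109 * (5 * m + 4) / 2 <= 276 * m];
   an abstract [C] keeps the terms built from this constant from unfolding. *)
have [C C276] : exists C, 276 <= C by exists 276.
pose D := 3 * C + 4; pose M := 2 * D + C + 1; pose q := 100 * p.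
pose b := 2 * (q * M); pose r := 36 * (p * b); pose K := 8 * D + 70 * C + 1.
pose t1 := 4 * D ^ 2 + (C + 1) ^ 2; pose t2 := r ^ 2 * (18 + M).
pose t3 := 2 * (p * b ^ 2); pose t4 := (4 * p + 1) * 3 * (D + 2) + 3 * p * K.
exists (64 + t1 + t2.+1 + t3 + t4.+1) => m T E mbig nm /andP [_ /existsP [F]].
move=> /andP [/and3P [/eqP defE /forallP Fcyc /forallP Fdisj] nC3].
have mk : m ^ 2 <= ex_C5_C3 #|T| by apply: ex_C5_C3_ge; case/andP: nm.
have [f fP] : exists f : 'I_(ex_C5_C3 #|T|) -> 'I_5 -> T, forall j,
    injective (f j) /\ F j = [set [set f j a; f j (ordS a)] | a : 'I_5].
  apply: (@fin_all_exists _ (fun=> 'I_5 -> T) (fun j h => injective h /\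
    F j = [set [set h a; h (ordS a)] | a : 'I_5])) => j.
  by have /existsP [h /andP [/injectiveP h_inj /eqP ->]] := Fcyc j; exists h.
have f_inj j : injective (f j) by case: (fP j).
have FE j : F j = [set [set f j a; f j (ordS a)] | a : 'I_5] by case: (fP j).
have F_disj i j : i != j -> [disjoint F i & F j].
  by move=> ij; have /forallP/(_ j)/implyP/(_ ij) := Fdisj i.
have dinj := darts_inj f_inj FE F_disj.
have tri u v w := @cherry_of_triangle _ _ _ _ _ f_inj FE defE u v w nC3.
have m32 : 32 <= m by lia.
have [g0 g0P] := first_classes dinj tri mk nm m32.
have g0C : stray_count f g0 <= C * m.
  have : 276 * m <= C * m by rewrite leq_mul2r C276 orbT.
  by case/andP: nm => _ nm2; lia.
have [g gP] : exists g, 2 * (p * stray_count f g) <= (4 * p + 3) * m.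
  apply: (refined_classes f_inj dinj tri p2 mk nm g0C).
  - by apply: (@leq_trans t1); [by [] | lia].
  - by apply: (@leq_trans t2.+1); [by [] | lia].
  - by apply: (@leq_trans t3); [by [] | lia].
  - by apply: (@leq_trans t4.+1); [by [] | lia].
exists g; split.
  apply: leq_trans gP; rewrite !leq_mul2l; apply/orP; right; apply/orP; right.
  exact: card_stray_edges FE defE g.
apply: (balanced_classes dinj p2 mk) gP; first by case/andP: nm.
by lia.
Qed.

Local Open Scope ring_scope.

Theorem theorem1p2 (R : realType) (delta : R) (hdelta : 0 < delta) :
  exists n_delta : nat, forall n : nat, (n_delta <= n)%N ->
  forall (T : finType) (E : {set {set T}}), #|T| = n ->
  extremal_multicolored_C3_free E ->
  exists A : 'I_5 -> {set T},
    vertex_partition A /\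
    (#|E :\: \bigcup_(i < 5) bipartite_between E (A i) (A (ordS i))|%:R
       <= 2 * n%:R / 5 + delta * n%:R :> R) /\
    (forall i : 'I_5,
       n%:R / 5 - 2 ^+ 4 <= #|A i|%:R :> R /\
       #|A i|%:R <= n%:R / 5 + 2 ^+ 6 :> R).
Proof.
(* With [1 / p <= delta], the bound [2 * p * X <= (4 * p + 3) * m] of
   [extremal_classes] becomes [X <= 2 * n / 5 + 3 * n / (10 * p)]. *)
pose p := (Num.bound delta^-1).+2.
have pdelta : 1 <= p%:R * delta.
  rewrite -ler_pdivrMr // mul1r.
  apply/ltW/(lt_le_trans (archi_boundP _)); first by rewrite invr_ge0 ltW.
  by rewrite ler_nat; exact: leqW (leqnSn _).
have [m0 Hm0] := @extremal_classes p isT.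
exists (5 * m0)%N => n n_big T E cardT extE.
pose m := (n %/ 5)%N.
have [n_ge n_le] : (5 * m <= n)%N /\ (n <= 5 * m + 4)%N by rewrite /m; lia.
have m_big : (m0 <= m)%N by rewrite /m; lia.
have T_m : (5 * m <= #|T| <= 5 * m + 4)%N by rewrite cardT n_ge.
have [g [gE gA]] := Hm0 m T E m_big T_m extE.
exists (part g); split; [split | split].
- move=> i j ij; rewrite -setI_eq0 -subset0; apply/subsetP => v.
  by rewrite !inE => /andP [/eqP -> /eqP ji]; rewrite ji eqxx in ij.
- by apply/setP => v; rewrite inE; apply/bigcupP; exists (g v); rewrite // inE.
- set X := #|_| in gE *.
  have {gE} XR : 2 * (p%:R * X%:R) <= (4 * p%:R + 3) * m%:R :> R.
    by rewrite -!(natrM, natrD) ler_nat.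
  have mR : 5 * m%:R <= n%:R :> R by rewrite -natrM ler_nat.
  have p0 : 0 < p%:R :> R by rewrite ltr0n.
  have n0 : 0 <= n%:R :> R by rewrite ler0n.
  rewrite -(ler_pM2l p0).
  have H1 : p%:R * (5 * m%:R) <= p%:R * n%:R :> R by rewrite ler_pM2l.
  have H2 : n%:R <= p%:R * delta * n%:R by rewrite -[X in X <= _]mul1r ler_wpM2r.
  lra.
move=> i; have [A_ge A_le] := gA i; split.
  have : (n <= 5 * #|part g i| + 69)%N by lia.
  by rewrite -(ler_nat R) natrD natrM; lra.
have : (5 * #|part g i| <= n + 50)%N by lia.
by rewrite -(ler_nat R) natrD natrM; lra.
Qed.
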